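(* For every $n\geq 1$, the set $B=\{b_1,\ldots,b_{n-1}\}$ is a generating set of minimum size of the monoid $\mathcal{IO}_n^+$.
   Context: Let $\Omega_n=\{1,\ldots,n\}$ with the usual linear order. Transformations of $\Omega_n$ are written on the right of their arguments and composed from left to right. $\mathcal{IO}_n$ is the monoid, under composition, of all full transformations $\alpha:\Omega_n\to\Omega_n$ that are order-preserving ($x\leq y$ implies $x\alpha\leq y\alpha$) and whose image is an interval of $\Omega_n$ (if $x\leq y\leq z$ and $x,z\in\mathrm{Im}(\alpha)$ then $y\in\mathrm{Im}(\alpha)$). $\mathcal{IO}_n^+$ is the submonoid of those $\alpha\in\mathcal{IO}_n$ with $x\leq x\alpha$ for all $x\in\Omega_n$. For $1\leq i\leq n-1$, $b_i\in\mathcal{IO}_n^+$ is the transformation with $xb_i=x+1$ for $x\leq i$ and $xb_i=x$ for $x\geq i+1$ (for $n=1$ the set $B$ is empty). Generating sets are taken in the sense of monoids (the identity is the empty product). *)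

(* Defs.v *)
From HB Require Import structures.
From mathcomp Require Import all_boot.

Set Implicit Arguments.
Unset Strict Implicit.
Unset Printing Implicit Defensive.

Local Open Scope group_scope.

#[short(type="finMonoidType")]
HB.structure Definition FinMonoid := {M of Finite M & Monoid M}.

Definition generates (M : finMonoidType) (A : {set M}) : Prop :=
  forall x : M, exists2 s : seq M, {subset s <= A} & x = \prod_(a <- s) a.

Definition min_generating_set (M : finMonoidType) (A : {set M}) : Prop :=
  generates A /\ forall C : {set M}, generates C -> #|A| <= #|C|.

(* The chain {1 < ... < n} is represented by 'I_n, with k : 'I_n standing for *)
(* k + 1. The alias keeps composition apart from the pointwise product that   *)
(* finite functions into a magma carry.                                       *)
Definition trans (n : nat) := {ffun 'I_n -> 'I_n}.

HB.instance Definition _ n := Finite.on (trans n).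

Section Transformations.

Variable n : nat.
Implicit Types a b c : trans n.

(* Maps act on the right: x (a b) = (x a) b. *)
Definition trans_mul a b : trans n := [ffun x => b (a x)].
Definition trans_one : trans n := [ffun x => x].

Lemma trans_mulA : associative trans_mul.
Proof. by move=> a b c; apply/ffunP=> x; rewrite !ffunE. Qed.

Lemma trans_mul1 : left_id trans_one trans_mul.
Proof. by move=> a; apply/ffunP=> x; rewrite !ffunE. Qed.

Lemma trans_mulr1 : right_id trans_one trans_mul.
Proof. by move=> a; apply/ffunP=> x; rewrite !ffunE. Qed.

HB.instance Definition _ :=
  isMonoid.Build (trans n) trans_mulA trans_mul1 trans_mulr1.

Lemma trans_mulE a b x : (a * b) x = b (a x).
Proof. exact: ffunE. Qed.

Lemma trans_oneE x : (1 : trans n) x = x.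
Proof. exact: ffunE. Qed.

Definition order_preserving a : bool :=
  [forall x : 'I_n, forall y : 'I_n, (x <= y) ==> (a x <= a y)].

Definition interval_image a : bool :=
  [forall x : 'I_n, forall y : 'I_n, forall z : 'I_n,
     [&& x <= y, y <= z, x \in codom a & z \in codom a] ==> (y \in codom a)].

Definition extensive a : bool := [forall x : 'I_n, x <= a x].

Definition IO : pred (trans n) :=
  [pred a | order_preserving a && interval_image a].

Definition IOplus_pred : pred (trans n) := [pred a | (a \in IO) && extensive a].

Lemma order_preservingP a :
  reflect {homo a : x y / x <= y} (order_preserving a).
Proof.
apply: (iffP 'forall_forallP) => [h x y|h x y]; first exact/implyP.
by apply/implyP; apply: h.
Qed.

Lemma interval_imageP a :
  reflect (forall x y z : 'I_n, x <= y -> y <= z ->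
             x \in codom a -> z \in codom a -> y \in codom a)
          (interval_image a).
Proof.
apply: (iffP 'forall_'forall_forallP) => [h x y z xy yz xa za|h x y z].
  by have /implyP := h x y z; apply; apply/and4P.
by apply/implyP=> /and4P[]; apply: h.
Qed.

Lemma extensiveP a : reflect (forall x : 'I_n, x <= a x) (extensive a).
Proof. exact: forallP. Qed.

Lemma IO_monoid_closed : monoid_closed IO.
Proof.
split=> [|a b /andP[/order_preservingP a_mono /interval_imageP a_int]].
  apply/andP; split; first by apply/order_preservingP=> x y; rewrite !trans_oneE.
  by apply/interval_imageP=> x y z _ _ _ _; apply/codomP; exists y;
     rewrite trans_oneE.
case/andP=> /order_preservingP b_mono /interval_imageP b_int.
apply/andP; split.
  by apply/order_preservingP=> x y /a_mono/b_mono; rewrite !trans_mulE.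
apply/interval_imageP=> x y z xy yz /codomP[u xE] /codomP[v zE].
rewrite trans_mulE in xE; rewrite trans_mulE in zE; subst x z.
have /codomP[t yE] : y \in codom b.
  exact: b_int xy yz (codom_f b (a u)) (codom_f b (a v)).
have [tu|/ltnW ut] := leqP t (a u).
  have -> : y = b (a u).
    by apply/val_inj/eqP; rewrite eqn_leq xy yE b_mono.
  by apply/codomP; exists u; rewrite trans_mulE.
have [tv|/ltnW vt] := leqP t (a v); last first.
  have -> : y = b (a v).
    by apply/val_inj/eqP; rewrite eqn_leq yz yE b_mono.
  by apply/codomP; exists v; rewrite trans_mulE.
have /codomP[w tE] : t \in codom a.
  exact: a_int ut tv (codom_f a u) (codom_f a v).
by apply/codomP; exists w; rewrite trans_mulE -tE.
Qed.

Lemma IOplus_monoid_closed : monoid_closed IOplus_pred.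
Proof.
have [IO1 IOM] := IO_monoid_closed.
split=> [|a b /andP[aIO /extensiveP a_ext] /andP[bIO /extensiveP b_ext]].
  by apply/andP; split=> //; apply/extensiveP=> x; rewrite trans_oneE.
apply/andP; split; first exact: IOM.
by apply/extensiveP=> x; rewrite trans_mulE (leq_trans (a_ext x)).
Qed.

Definition IOplus := {a : trans n | IOplus_pred a}.

HB.instance Definition _ := [Finite of IOplus by <:].
HB.instance Definition _ := SubType.on IOplus.
HB.instance Definition _ :=
  SubChoice_isSubMonoid.Build (trans n) IOplus_pred IOplus IOplus_monoid_closed.

(* With both i and x shifted by one, the condition x <= i is unchanged; thus  *)
(* i : 'I_n.-1 gives b_(i + 1). Since x <= i implies x + 1 < n, the default   *)
(* value of insubd is never used.                                             *)
Definition b_trans (i : 'I_n.-1) : trans n :=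
  [ffun x : 'I_n => if x <= i then insubd x x.+1 else x].

Lemma b_transE i x : b_trans i x = (if x <= i then x.+1 else x) :> nat.
Proof.
rewrite ffunE; case: ifP => // xi; rewrite insubdK //.
have : i.+1 < n by rewrite -ltn_predRL.
exact: leq_ltn_trans.
Qed.

Lemma b_trans_IOplus i : IOplus_pred (b_trans i).
Proof.
have bE := b_transE i.
apply/andP; split; last first.
  by apply/extensiveP=> x; rewrite bE; case: ifP => // _; exact: leqnSn.
apply/andP; split.
  apply/order_preservingP=> x y xy; rewrite !bE.
  have [yi|iy] := leqP y i; first by rewrite (leq_trans xy yi).
  by have [xi|//] := leqP x i; rewrite (leq_ltn_trans xi).
apply/interval_imageP=> x y z xy yz /codomP[u xE] _.
have y_gt0 : 0 < y.
  apply: leq_trans xy; rewrite xE bE; case: ifP => // /negbT.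
  by rewrite -ltnNge; apply: leq_trans.
have [yi|iy] := leqP y i.+1; last first.
  by apply/codomP; exists y; apply: val_inj; rewrite /= bE leqNgt (ltnW iy).
have yn : y.-1 < n by rewrite (leq_ltn_trans (leq_pred y)).
apply/codomP; exists (Ordinal yn); apply: val_inj; rewrite /= bE /=.
by rewrite -ltnS prednK // yi.
Qed.

Definition b (i : 'I_n.-1) : IOplus := Sub (b_trans i) (b_trans_IOplus i).

Definition B : {set IOplus} := [set b i | i : 'I_n.-1].

End Transformations.

(* Main.v *)
Require Import Defs.
From mathcomp Require Import all_boot.

(** A non-identity [a] in IO_n^+ moves every point below its least fixed point
    [m], and [m] is not the first point. If [i + 1] is that fixed point, then
    [a = b_i c], where [c] is [a] delayed by one step on the points up to [m];
    as [c] has a smaller sum of values, induction shows that the [b_i] generate.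
    Conversely, comparing least fixed points shows that [b_i = c d] forces
    [c = 1] or [c = b_i], so every generating set contains every [b_i]. *)

Set Implicit Arguments.
Unset Strict Implicit.
Unset Printing Implicit Defensive.

Local Open Scope group_scope.

Section Generation.

Variables (n : nat) (n_gt0 : 0 < n).
Implicit Types (a c d : IOplus n) (x y m : 'I_n).

Let zero : 'I_n := Ordinal n_gt0.

Definition opred x : 'I_n := insubd x x.-1.

Lemma val_opred x : opred x = x.-1 :> nat.
Proof. by rewrite val_insubd (leq_ltn_trans (leq_pred x)). Qed.

Lemma IOplus_mono a : {homo val a : x y / x <= y}.
Proof. by case/andP: (valP a) => /andP[/order_preservingP]. Qed.

Lemma IOplus_ext a x : x <= val a x.
Proof. by case/andP: (valP a) => _ /extensiveP. Qed.

Lemma IOplus_mulE a c x : val (a * c) x = val c (val a x).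
Proof. exact: trans_mulE. Qed.

Lemma IOplus_eqP a c : (forall x, val a x = val c x :> nat) -> a = c.
Proof. by move=> e; apply/val_inj/ffunP=> x; apply/val_inj/e. Qed.

Lemma extensive_max (f : trans n) :
  extensive f -> exists2 m, f m = m & forall y, y <= m.
Proof.
move=> /extensiveP f_ext.
have top_ltn : n.-1 < n by rewrite prednK.
have max_top y : y <= n.-1 by rewrite -ltnS prednK.
exists (Ordinal top_ltn) => //=.
by apply/val_inj/eqP; rewrite eqn_leq f_ext max_top.
Qed.

(** The image is an interval, and it contains the last point, which extensivity fixes. *)
Lemma IOplus_codom a y : val a zero <= y -> y \in codom (val a).
Proof.
case/andP: (valP a) => /andP[_ /interval_imageP a_int] a_ext a0y.
have [m am m_max] := extensive_max a_ext.
by apply: a_int a0y (m_max y) (codom_f _ _) _; rewrite -am codom_f.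
Qed.

(** By [IOplus_codom], [a] is onto. A preimage [y] of [x] satisfies [y <= x]; if [y < x], then [y]
    is fixed by induction, which contradicts [y] being sent to [x]. *)
Lemma IOplus_fix0 a : val a zero = zero -> a = 1.
Proof.
move=> a0; apply: IOplus_eqP => x; rewrite trans_oneE.
have [k] := ubnP x; elim: k x => // k IHk x xk.
have /codomP[y xE] : x \in codom (val a) by apply: IOplus_codom; rewrite a0.
have : y <= x by rewrite xE IOplus_ext.
rewrite leq_eqVlt => /orP[/eqP yx|yx].
  by rewrite -[in LHS](val_inj yx) -xE.
by have := IHk y (leq_trans yx xk); rewrite -xE => /esym xy;
  rewrite xy ltnn in yx.
Qed.

(** The last point is fixed, so a least fixed point exists. By [IOplus_fix0] it is not the first
    point, so its predecessor is an index for [b]. *)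
Lemma least_fixed_point a : a != 1 ->
  exists i : 'I_n.-1, exists2 m : 'I_n, i.+1 = m &
    val a m = m /\ forall x, x <= i -> x < val a x.
Proof.
move=> a1; have /andP[_ a_ext] := valP a.
have [t at_ _] := extensive_max a_ext.
case: (@arg_minnP _ t (fun x => val a x == x) (@nat_of_ord n)); first exact/eqP.
move=> m /eqP am m_min.
have m_gt0 : 0 < m.
  rewrite lt0n; apply: contra_neq a1 => m0; apply: IOplus_fix0.
  by have <- : m = zero by apply: val_inj.
have lt_i : m.-1 < n.-1 by rewrite ltn_predRL prednK.
exists (Ordinal lt_i), m; rewrite /= ?prednK //; split=> // x xi.
rewrite ltn_neqAle IOplus_ext andbT; apply/eqP => xE.
have /m_min : val a x == x by rewrite -val_eqE /= -xE.
by rewrite leqNgt -(prednK m_gt0) ltnS xi.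
Qed.

(* The value at the first point is free up to an interval condition; lowering *)
(* it by one, rather than keeping it, makes the sum of values decrease.       *)
Definition delay a m : trans n :=
  [ffun x => if x == zero then opred (val a zero)
             else if x <= m then val a (opred x) else val a x].

Section Delay.

Variables (a : IOplus n) (i : 'I_n.-1) (m : 'I_n).
Hypotheses (im : i.+1 = m) (am : val a m = m).
Hypothesis a_gt : forall x, x <= i -> x < val a x.

Lemma delay0 : delay a m zero = (val a zero).-1 :> nat.
Proof. by rewrite ffunE eqxx val_opred. Qed.

Lemma delayS x y : x <= i -> y = x.+1 :> nat -> delay a m y = val a x.
Proof.
move=> xi yE; rewrite ffunE -val_eqE /= yE -im ltnS xi /=.
by have -> : opred y = x by apply: val_inj; rewrite /= val_opred yE.
Qed.

(** The critical point is [m]: there the delayed map takes the value of [a] at [i], which exceeds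
    [i] and is at most [val a m = m]. *)
Lemma delay_ge x : m <= x -> delay a m x = val a x.
Proof.
move=> mx; have [xm|/negbTE xm] := boolP (x <= m); last first.
  by rewrite ffunE xm -val_eqE /= eqn0Ngt (leq_trans _ mx) // -im.
have -> : x = m by apply/val_inj/eqP; rewrite eqn_leq xm mx.
pose y := opred m.
have yE : y = i :> nat by rewrite val_opred -im.
rewrite (@delayS y) ?yE //; apply/val_inj/eqP.
rewrite eqn_leq IOplus_mono ?yE -?im ?leqnSn //= am -im -yE.
by rewrite a_gt ?yE.
Qed.

Lemma delay_le x : delay a m x <= val a x.
Proof.
rewrite ffunE; case: eqP => [->|_]; first by rewrite val_opred leq_pred.
by case: ifP => // _; rewrite IOplus_mono // val_opred leq_pred.
Qed.

(** Extensivity survives the delay because [a] moves every point below [m] strictly up. The image is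
    that of [a] together with the value just below its least one. *)
Lemma delay_IOplus : IOplus_pred (delay a m).
Proof.
have c_ext : extensive (delay a m).
  apply/extensiveP => x; have [xm|mx] := leqP x m; last first.
    by rewrite delay_ge ?IOplus_ext // ltnW.
  have [->//|x_gt0] := posnP x.
  have xi : opred x <= i by rewrite val_opred -ltnS prednK // im.
  by rewrite (delayS xi) ?val_opred ?prednK //; have := a_gt xi;
    rewrite val_opred prednK.
apply/andP; split=> //; apply/andP; split.
  apply/order_preservingP => x y xy; have [my|ym] := leqP m y.
    by rewrite (delay_ge my) (leq_trans (delay_le x)) ?IOplus_mono.
  rewrite !ffunE (ltnW ym) (leq_trans xy (ltnW ym)) -!val_eqE /=.
  have [x0|x_gt0] := posnP x; have [y0|y_gt0] := posnP y => //.
  - by rewrite val_opred (leq_trans (leq_pred _)) ?IOplus_mono.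
  - by rewrite y0 leqNgt x_gt0 in xy.
  by rewrite IOplus_mono // !val_opred -!subn1 leq_sub2r.
have low y : delay a m zero <= y -> y \in codom (delay a m).
  rewrite delay0 leq_eqVlt => /predU1P[y0|].
    by apply/codomP; exists zero; apply: val_inj; rewrite /= delay0.
  rewrite prednK; last exact: (@a_gt zero).
  move/IOplus_codom/codomP=> [x ->].
  (* The value of [a] at [x] is still taken, at [x] itself if [m <= x] and at [x + 1] otherwise. *)
  have [mx|xm] := leqP m x; first by rewrite -delay_ge ?codom_f.
  have xn : x.+1 < n by exact: leq_ltn_trans xm (ltn_ord m).
  by rewrite -(@delayS x (Ordinal xn)) ?codom_f // -ltnS im.
apply/interval_imageP => x y z xy _ /codomP[u xE] _; apply: low.
apply: leq_trans xy; rewrite xE delay0.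
have [um|mu] := leqP u m; last first.
  by rewrite (delay_ge (ltnW mu)) (leq_trans (leq_pred _)) ?IOplus_mono.
rewrite ffunE um; case: eqP => [_|_]; first by rewrite val_opred.
by rewrite (leq_trans (leq_pred _)) ?IOplus_mono.
Qed.

Lemma b_delay : a = b i * Sub (delay a m) delay_IOplus.
Proof.
apply: IOplus_eqP => x; rewrite IOplus_mulE !SubK.
have [xi|ix] := leqP x i; first by rewrite (delayS xi) // b_transE xi.
have -> : b_trans i x = x by apply: val_inj; rewrite /= b_transE leqNgt ix.
by rewrite delay_ge // -im.
Qed.

(** The first point is not fixed, so its value is positive and drops; no other value grows. *)
Lemma delay_sum : \sum_x delay a m x < \sum_x val a x.
Proof.
rewrite (bigD1 zero) //= [X in _ < X](bigD1 zero) //= -addSn delay0.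
rewrite prednK; last exact: (@a_gt zero).
by rewrite leq_add2l leq_sum // => x _; exact: delay_le.
Qed.

End Delay.

Lemma generates_B : generates (B n).
Proof.
move=> a; have [k] := ubnP (\sum_x val a x); elim: k a => // k IHk a ak.
have [->|a1] := eqVneq a 1; first by exists [::]; rewrite ?big_nil.
have [i [m im [am a_gt]]] := least_fixed_point a1.
have [|s sB sE] := IHk (Sub (delay a m) (delay_IOplus im am a_gt)).
  rewrite SubK; exact: leq_trans (delay_sum m a_gt) _.
exists (b i :: s); last by rewrite big_cons -sE -b_delay.
by move=> c; rewrite inE => /predU1P[->|/sB//]; apply: imset_f.
Qed.

(** Since [d] is extensive, [c] lies pointwise below [b i]: it moves points by at most one, and only
    points up to [i]. What remains is that it moves all of these. *)
Lemma b_irreducible (i : 'I_n.-1) c d : b i = c * d -> c != 1 -> c = b i.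
Proof.
move=> bE c1; have [j [m jm [cm c_gt]]] := least_fixed_point c1.
have cdE x : val d (val c x) = (if x <= i then x.+1 else x) :> nat.
  by rewrite -IOplus_mulE -bE SubK b_transE.
have c_le x : val c x <= (if x <= i then x.+1 else x).
  by rewrite -cdE IOplus_ext.
have cS x : x <= j -> x <= i /\ val c x = x.+1 :> nat.
  move=> /c_gt cx; have := c_le x; case: ifP => [xi|_] cx'.
    by split=> //; apply/eqP; rewrite eqn_leq cx' cx.
  by have := leq_trans cx cx'; rewrite ltnn.
have y_ltn : j < n by exact: leq_trans (ltn_ord j) (leq_pred n).
have [ji cj] := cS (Ordinal y_ltn) (leqnn j).
(* If [j < i], then [c] sends both [j] and [m] to [m], whereas [b i] separates these two points. *)
have ij : i <= j.
  rewrite leqNgt; apply/negP => ij.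
  have := cdE m; rewrite cm -jm ij.
  have <- : val c (Ordinal y_ltn) = m by apply: val_inj; rewrite /= cj.
  by rewrite cdE /= ji => /eqP; rewrite eqn_leq ltnn andbF.
apply: IOplus_eqP => x; rewrite SubK b_transE.
case: ifP => [xi|xi]; first by case: (cS x (leq_trans xi ij)).
by apply/eqP; rewrite eqn_leq IOplus_ext andbT; have := c_le x; rewrite xi.
Qed.

Lemma b_neq1 (i : 'I_n.-1) : b i != 1.
Proof.
apply/eqP => b1; have := b_transE i zero.
by rewrite -[b_trans i]/(val (b i)) b1 trans_oneE.
Qed.

Lemma b_in_factors (i : 'I_n.-1) (s : seq (IOplus n)) :
  b i = \prod_(a <- s) a -> b i \in s.
Proof.
elim: s => [|c s IHs].
  by rewrite big_nil => /eqP; rewrite (negbTE (b_neq1 i)).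
rewrite big_cons inE => bE; have [c1|c1] := eqVneq c 1.
  by rewrite IHs ?orbT // bE c1 mul1g.
by rewrite (b_irreducible bE c1) eqxx.
Qed.

Lemma B_subset_generates (C : {set IOplus n}) : generates C -> B n \subset C.
Proof.
move=> genC; apply/subsetP => _ /imsetP[i _ ->].
by have [s sC /b_in_factors/sC] := genC (b i).
Qed.

End Generation.

Theorem mainTheorem4 (n : nat) (n_gt0 : 0 < n) : min_generating_set (B n).
Proof.
split; first exact: generates_B.
by move=> C /(B_subset_generates n_gt0)/subset_leq_card.
Qed.
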